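(* The tree defined by the level sets $\mathcal{T}_n$ is complete, that is, $$\bigcup_{n\ge-1}\mathcal{T}_n=\mathbb{Q}^2\cap\overline{\triangle},$$ and every pair of rational numbers in $\overline{\triangle}$ appears in the tree exactly once (i.e. the sets $\mathcal{T}_n$ are pairwise disjoint, and each point of $\mathcal{T}_n$, $n\ge1$, is produced by exactly one application of one of the generating rules).
   Context: $\overline{\triangle}=\{(x,y)\in\mathbb{R}^2:1\ge x\ge y\ge0\}$, with boundary $\partial\triangle$ and interior $\mathring{\triangle}$. Let $\phi_0(x,y)=\left(\frac{1}{1+y},\frac{x}{1+y}\right)$, $\phi_1(x,y)=\left(\frac{x}{1+y},\frac{y}{1+y}\right)$ and $\phi_2(x,x)=(x,0)$. The levels $\mathcal{T}_n$, $n\ge-1$, of the tree are defined as follows, where $\mathcal{B}_n=\mathcal{T}_n\cap\partial\triangle$ and $\mathcal{I}_n=\mathcal{T}_n\cap\mathring{\triangle}$. Set $\mathcal{T}_{-1}=\{(0,0),(1,0),(1,1)\}$ and $\mathcal{T}_0=\{(\frac12,0),(1,\frac12),(\frac12,\frac12)\}$. For $n\ge0$ the points of $\mathcal{T}_{n+1}$ are exactly those generated by the following rules: (R1) an interior point $(\frac pq,\frac rq)\in\mathcal{I}_n$ generates the two interior points $\phi_0(\frac pq,\frac rq)=(\frac{q}{r+q},\frac{p}{r+q})$ and $\phi_1(\frac pq,\frac rq)=(\frac{p}{r+q},\frac{r}{r+q})$ in $\mathcal{I}_{n+1}$; (R2) a boundary point $(\frac pq,\frac pq)\in\mathcal{B}_n$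 generates $\phi_2(\frac pq,\frac pq)=(\frac pq,0)\in\mathcal{B}_n$ (same level) and $\phi_1(\frac pq,\frac pq)=(\frac{p}{p+q},\frac{p}{p+q})\in\mathcal{B}_{n+1}$; (R3) a boundary point $(\frac pq,0)\in\mathcal{B}_n$ generates $\phi_0(\frac pq,0)=(1,\frac pq)\in\mathcal{B}_n$ (same level); (R4) a boundary point $(1,\frac pq)\in\mathcal{B}_n$ generates $\phi_0(1,\frac pq)=(\frac{q}{p+q},\frac{q}{p+q})\in\mathcal{B}_{n+1}$ and $\phi_1(1,\frac pq)=(\frac{q}{p+q},\frac{p}{p+q})\in\mathcal{I}_{n+1}$. (The same-level parts of R2 and R3 are applied at every level $n\ge0$.) *)

(* Defs.v *)
From mathcomp Require Import all_boot all_order all_algebra.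
From mathcomp Require Import all_classical all_reals all_analysis.

Import Order.TTheory GRing.Theory Num.Theory.
Import numFieldNormedType.Exports.

Local Open Scope classical_set_scope.
Local Open Scope ring_scope.

Definition triangle (R : realType) : set (R * R) :=
  [set z | 1 >= z.1 /\ z.1 >= z.2 /\ z.2 >= 0].

Definition triangle_interior (R : realType) : set (R * R) :=
  interior (triangle R).

Definition triangle_boundary (R : realType) : set (R * R) :=
  closure (triangle R) `\` interior (triangle R).

Definition phi0 (R : realType) (z : R * R) : R * R :=
  (1 / (1 + z.2), z.1 / (1 + z.2)).

Definition phi1 (R : realType) (z : R * R) : R * R :=
  (z.1 / (1 + z.2), z.2 / (1 + z.2)).

(* Only ever applied to points of the diagonal (see [branch_dom]). *)
Definition phi2 (R : realType) (z : R * R) : R * R := (z.1, 0).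

(* A rule that generates two points is split into two branches. *)
Inductive branch : Type :=
  | R1_phi0 | R1_phi1
  | R2_phi2 | R2_phi1
  | R3_phi0
  | R4_phi0 | R4_phi1.

Definition branch_dom (R : realType) (b : branch) : set (R * R) :=
  match b with
  | R1_phi0 | R1_phi1 => triangle_interior R
  | R2_phi2 | R2_phi1 => triangle_boundary R `&` [set z | z.1 = z.2]
  | R3_phi0 => triangle_boundary R `&` [set z | z.2 = 0]
  | R4_phi0 | R4_phi1 => triangle_boundary R `&` [set z | z.1 = 1]
  end.

Definition branch_map (R : realType) (b : branch) : R * R -> R * R :=
  match b with
  | R1_phi0 | R3_phi0 | R4_phi0 => phi0 R
  | R1_phi1 | R2_phi1 | R4_phi1 => phi1 R
  | R2_phi2 => phi2 R
  end.

(* Level of the generated point minus level of the generating point. *)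
Definition branch_shift (b : branch) : int :=
  match b with
  | R2_phi2 | R3_phi0 => 0
  | _ => 1
  end.

(* [level R n] is empty for n < -1.  The rules act on levels n >= 0 only, so
   the three vertices generate nothing. *)
Inductive level (R : realType) : int -> set (R * R) :=
  | level_m1 (z : R * R) :
      [set (0, 0); (1, 0); (1, 1)] z -> level R (-1) z
  | level_0 (z : R * R) :
      [set (2^-1, 0); (1, 2^-1); (2^-1, 2^-1)] z -> level R 0 z
  | level_gen (b : branch) (n : int) (z : R * R) :
      0 <= n -> level R n z -> branch_dom R b z ->
      level R (n + branch_shift b) (branch_map R b z).

(* A triple (b, m, z) is an application of branch b to the point z of level m;
   [produces R a n w] says that a is a legal application and that its result is
   the point w of level n. *)
Definition produces (R : realType) (a : branch * int * (R * R))
    (n : int) (w : R * R) : Prop :=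
  let: (b, m, z) := a in
  [/\ 0 <= m, level R m z, branch_dom R b z,
      n = m + branch_shift b & w = branch_map R b z].

(* Main.v *)
(** Away from the three vertices, the seven branches of the rules are injective,
    and their images are pairwise disjoint: in the open triangle they are told
    apart by the position of [x + y] with respect to [1], and on the diagonal by
    the position of [x] with respect to [1/2].  So a point has at most one
    predecessor, which yields uniqueness and, by following predecessors back to
    level [0], disjointness of the levels.  Every non-vertex except the midpoint
    of the diagonal has a predecessor.  Passing to it lowers the common
    denominator, except for the same-level rules, which only move a point of a
    side towards the diagonal; so a rational point descends to [(1/2, 1/2)]. *)

Require Import Defs.
From mathcomp Require Import all_boot all_order all_algebra.
From mathcomp Require Import all_classical all_reals all_analysis.
From mathcomp Require Import zify ring lra.

Import Order.TTheory GRing.Theory Num.Theory.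
Import numFieldNormedType.Exports.

Local Open Scope classical_set_scope.
Local Open Scope ring_scope.

(** * Topology of the triangle: interior and boundary as explicit inequalities *)

Lemma triangle_closed (R : realType) : closed (triangle R).
Proof.
have cvx (z : R * R) : {for z, continuous (fun z : R * R => z.1)}.
  exact: cvg_fst.
have cvy (z : R * R) : {for z, continuous (fun z : R * R => z.2)}.
  exact: cvg_snd.
have -> : triangle R = (fun z : R * R => z.1) @^-1` [set x | x <= 1] `&`
   ((fun z : R * R => z.1 - z.2) @^-1` [set x | 0 <= x] `&`
   (fun z : R * R => z.2) @^-1` [set x | 0 <= x]).
  by apply/seteqP; split=> -[x y] /=; rewrite subr_ge0.
apply: closedI; last apply: closedI.
- by apply: preimage_closed; [move=> z _; exact: cvx|exact: closed_le].
- apply: preimage_closed; last exact: closed_ge.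
  by move=> z _; apply: cvgB; [exact: cvx|exact: cvy].
- by apply: preimage_closed; [move=> z _; exact: cvy|exact: closed_ge].
Qed.

Lemma triangle_interiorE (R : realType) :
  triangle_interior R = [set z | 0 < z.2 /\ z.2 < z.1 /\ z.1 < 1].
Proof.
apply/seteqP; split=> -[x y] /=.
- move/nbhs_ballP => [e /= e0 sub].
  have near0 (d : R) : `|d| <= e / 2 -> `|d| < e by move: e0; lra.
  (* Shifts by [e / 2] to the right, to the left and downwards stay in the triangle; each makes one
     of its three inequalities strict. *)
  have h d1 d2 : `|d1| <= e / 2 -> `|d2| <= e / 2 ->
      triangle R (x - d1, y - d2).
    move=> h1 h2; apply: sub; split; rewrite /ball /= opprB addrCA subrr addr0;
    exact: near0.
  have e2 : 0 < e / 2 by move: e0; lra.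
  have n2 : `|e / 2| <= e / 2 by rewrite ger0_norm // ltW.
  have n2' : `|- (e / 2)| <= e / 2 by rewrite normrN.
  have n0 : `|0 : R| <= e / 2 by rewrite normr0 ltW.
  have [/= ? _] := h _ _ n2' n0.
  have [/= _ [? _]] := h _ _ n2 n0.
  have [/= _ [_ ?]] := h _ _ n0 n2.
  by lra.
- move=> [y0 [yx x1]].
  (* [x - y] is halved because both coordinates may move towards each other. *)
  have d0 : 0 < Num.min y (Num.min ((x - y) / 2) (1 - x)).
    by rewrite !lt_min; lra.
  apply/nbhs_ballP; exists (Num.min y (Num.min ((x - y) / 2) (1 - x))) => //.
  move=> -[u v] [/=]; rewrite /ball /= !lt_min /triangle /= !ltr_norml.
  lra.
Qed.

Lemma triangle_boundaryE (R : realType) :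
  triangle_boundary R =
  triangle R `&` [set z | z.2 = 0 \/ z.1 = z.2 \/ z.1 = 1].
Proof.
rewrite /triangle_boundary -(closure_id _).1; last exact: triangle_closed.
rewrite -/(triangle_interior R) triangle_interiorE.
apply/seteqP; split=> -[x y] /=.
- rewrite /triangle /= => -[[x1 [yx y0]] h]; split => //.
  apply: contrapT => g; apply: h; rewrite !lt_neqAle y0 yx x1 !andbT.
  by split; [|split]; apply/eqP => e; apply: g; [left|right; left|right; right].
- rewrite /triangle /= => -[[x1 [yx y0]] h]; split => //.
  by case: h => [|[]]; lra.
Qed.

(** * The branches as bijections from sources to disjoint images *)

(* [branch_dom] without the three vertices, which the rules never reach. *)
Definition branch_source (R : realType) (b : branch) : set (R * R) :=
  [set z | match b with
  | R1_phi0 | R1_phi1 => [/\ 0 < z.2, z.2 < z.1 & z.1 < 1]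
  | R2_phi2 | R2_phi1 => [/\ z.2 = z.1, 0 < z.1 & z.1 < 1]
  | R3_phi0 => [/\ z.2 = 0, 0 < z.1 & z.1 < 1]
  | R4_phi0 | R4_phi1 => [/\ z.1 = 1, 0 < z.2 & z.2 < 1]
  end].

(** The exact image of [branch_source]: [branch_image_map] gives one inclusion, [branch_source_inv]
    and [branch_invK] the other. *)
Definition branch_image (R : realType) (b : branch) : set (R * R) :=
  [set z | match b with
  | R1_phi0 => [/\ 1 < z.1 + z.2, z.2 < z.1 & z.1 < 1]
  | R1_phi1 => [/\ 0 < z.2, z.2 < z.1 & z.1 + z.2 < 1]
  | R2_phi2 => [/\ z.2 = 0, 0 < z.1 & z.1 < 1]
  | R2_phi1 => [/\ z.2 = z.1, 0 < z.1 & z.1 < 2^-1]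
  | R3_phi0 => [/\ z.1 = 1, 0 < z.2 & z.2 < 1]
  | R4_phi0 => [/\ z.2 = z.1, 2^-1 < z.1 & z.1 < 1]
  | R4_phi1 => [/\ z.1 + z.2 = 1, 0 < z.2 & z.2 < z.1]
  end].

(** Solved through [1 + y], which is the inverse of the first coordinate of a value of [phi0] and of
    one minus the second coordinate of a value of [phi1]. *)
Definition branch_inv (R : realType) (b : branch) (z : R * R) : R * R :=
  match b with
  | R1_phi0 | R3_phi0 | R4_phi0 => (z.2 / z.1, z.1^-1 - 1)
  | R1_phi1 | R2_phi1 | R4_phi1 => (z.1 / (1 - z.2), z.2 / (1 - z.2))
  | R2_phi2 => (z.1, z.1)
  end.

(* This is the triangle minus its vertices; see [nonvertexE]. *)
Definition nonvertex (R : realType) : set (R * R) :=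
  [set z | exists b, branch_source R b z].

Lemma branch_image_map (R : realType) b (z : R * R) :
  branch_source R b z -> branch_image R b (branch_map R b z).
Proof.
case: z => x y; case: b;
  rewrite /branch_source /branch_image /= => -[h1 h2 h3];
  (have y1 : 0 < 1 + y by lra); have yn := lt0r_neq0 y1; subst; split => //=;
  rewrite -?mulrDl ?add0r ?mul0r ?mul1r //;
  rewrite ?[_^-1 < _]ltf_pV2 ?posrE ?ltr_pdivlMr ?ltr_pdivrMr ?invf_lt1
     ?invf_gt1 ?divr_gt0 ?invr_gt0 ?mul0r ?mul1r //; try lra; try by field.
all: by rewrite ?mulVf ?mulfVK ?[_^-1 < _]ltf_pV2 ?posrE //; lra.
Qed.

Lemma branch_mapK (R : realType) b (z : R * R) :
  branch_source R b z -> branch_inv R b (branch_map R b z) = z.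
Proof.
case: z => x y; case: b; rewrite /branch_source /= => -[h1 h2 h3];
  (have yn : 1 + y != 0 by apply: lt0r_neq0; lra);
  subst; rewrite /= ?addr0 ?divr1 //; congr pair; field => //.
all: by rewrite ?yn ?andbT //= subr_eq0 ?oner_eq0; apply/eqP; lra.
Qed.

Lemma branch_source_inv (R : realType) b (z : R * R) :
  branch_image R b z -> branch_source R b (branch_inv R b z).
Proof.
case: z => x y; case: b; rewrite /branch_source /branch_image /=
  => -[h1 h2 h3].
- have x0 : 0 < x by lra.
  have y0 : 0 < y by lra.
  split; first by rewrite subr_gt0 invf_gt1.
    by rewrite ltr_pdivlMr // mulrBl mulVf ?lt0r_neq0 //; lra.
  by rewrite ltr_pdivrMr ?mul1r.
- have y1 : 0 < 1 - y by lra.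
  split; first by rewrite divr_gt0.
    by rewrite ltr_pM2r ?invr_gt0.
  by rewrite ltr_pdivrMr // mul1r; lra.
- by split.
- have x1 : 0 < 1 - x by lra.
  by subst y; split; rewrite ?divr_gt0 ?ltr_pdivrMr ?mul1r //; lra.
- by subst x; rewrite invr1 mulr1 subrr.
- have x0 : 0 < x by lra.
  subst y; rewrite divff ?lt0r_neq0 // subr_gt0 invf_gt1 // ltrBlDr.
  by split=> //; rewrite invf_plt ?posrE //; lra.
(* On the antidiagonal the preimage becomes [(x / x, y / x)], a point of the right side. *)
- have -> : 1 - y = x by lra.
  have x0 : 0 < x by lra.
  by rewrite divff ?lt0r_neq0 // divr_gt0 // ltr_pdivrMr // mul1r.
Qed.

Lemma branch_invK (R : realType) b (z : R * R) :
  branch_image R b z -> branch_map R b (branch_inv R b z) = z.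
Proof.
case: z => x y; case: b; rewrite /branch_image /= => -[h1 h2 h3].
all: rewrite /phi0 /phi1 /phi2 /=.
all: have xn : x != 0 by apply: lt0r_neq0; lra.
all: try (have yn : 1 - y != 0 by apply: lt0r_neq0; lra).
all: subst; congr pair; field.
all: rewrite ?xn ?yn ?oner_eq0 //=; apply: lt0r_neq0; lra.
Qed.

Lemma branch_image_disjoint (R : realType) b b' (z : R * R) :
  branch_image R b z -> branch_image R b' z -> b = b'.
Proof.
case: z => x y; case: b; case: b' => //;
 rewrite /branch_image /= => -[? ? ?] [? ? ?]; exfalso; lra.
Qed.

Lemma branch_image_nonvertex (R : realType) b (z : R * R) :
  branch_image R b z -> nonvertex R z.
Proof.
(* One branch stands for each region containing an image: [R1_phi0] for the open triangle, [R3_phi0]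
   for the bottom, [R2_phi2] for the diagonal, [R4_phi0] for the right side. *)
move=> bz; exists (match b with
  | R1_phi0 | R1_phi1 | R4_phi1 => R1_phi0
  | R2_phi2 => R3_phi0
  | R2_phi1 | R4_phi0 => R2_phi2
  | R3_phi0 => R4_phi0 end).
by case: z bz => x y; case: b; rewrite /branch_image /branch_source /=
  => -[? ? ?]; split; lra.
Qed.

Lemma nonvertex_triangle (R : realType) : nonvertex R `<=` triangle R.
Proof.
move=> [x y] [b]; rewrite /triangle /=.
by case: b; rewrite /branch_source /= => -[? ? ?]; lra.
Qed.

Lemma nonvertexE (R : realType) :
  nonvertex R = triangle R `\` [set (0, 0); (1, 0); (1, 1)].
Proof.
apply/seteqP; split=> [z nz|[x y]].
  split; first exact: nonvertex_triangle.
  by case: nz => b /[swap] -[[->|->]|->]; case: b;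
    rewrite /branch_source /= => -[? ? ?]; lra.
rewrite /triangle /= => -[[x1 [yx y0]] nv].
have [y00|yn0] := eqVneq y 0.
  exists R3_phi0; split => //=; rewrite lt_neqAle ?x1 -?y00 ?yx ?andbT.
    by apply/eqP => yx'; apply: nv; left; left; rewrite -yx' y00.
  by apply/eqP => xx; apply: nv; left; right; rewrite xx y00.
have [xx|xn1] := eqVneq x 1.
  exists R4_phi0; split => //=; first by rewrite lt_neqAle eq_sym yn0.
  rewrite lt_neqAle -{2}xx yx andbT.
  by apply/eqP => yy; apply: nv; right; rewrite xx yy.
have xlt1 : x < 1 by rewrite lt_neqAle xn1.
have ygt0 : 0 < y by rewrite lt_neqAle eq_sym yn0.
have [yx'|ynx] := eqVneq y x.
  by exists R2_phi2; split => //=; lra.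
by exists R1_phi0; split => //=; rewrite lt_neqAle ynx.
Qed.

Lemma branch_source_dom (R : realType) b (z : R * R) :
  branch_source R b z -> branch_dom R b z.
Proof.
rewrite /branch_dom triangle_interiorE triangle_boundaryE /triangle.
by case: z => x y; case: b; rewrite /branch_source /= => -[? ? ?];
  repeat split; lra.
Qed.

(** Two sides of the triangle meet only at a vertex, so away from the vertices the remaining
    inequalities on a side are strict. *)
Lemma branch_dom_source (R : realType) b (z : R * R) :
  nonvertex R z -> branch_dom R b z -> branch_source R b z.
Proof.
rewrite /branch_dom triangle_interiorE triangle_boundaryE => -[b'].
by case: z => x y; case: b'; case: b; rewrite /branch_source /=
  => -[? ? ?] ?; split; lra.
Qed.

(** * Unique predecessors and disjointness of the levels *)

Definition seeds (R : realType) : set (R * R) :=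
  [set (2^-1, 0); (1, 2^-1); (2^-1, 2^-1)].

Lemma seeds_nonvertex (R : realType) : seeds R `<=` nonvertex R.
Proof.
by move=> _ [[->|->]|->]; [exists R3_phi0|exists R4_phi0|exists R2_phi2];
  split=> /=; lra.
Qed.

(** This puts every legal application inside [branch_source], where the branches are invertible. *)
Lemma level_ge0_nonvertex (R : realType) n (z : R * R) :
  0 <= n -> level R n z -> nonvertex R z.
Proof.
move=> n0 lz; elim: lz n0 => {n z} // [z sz _|b n z n0 _ IH dz _].
  exact: seeds_nonvertex.
apply: (@branch_image_nonvertex _ b).
by apply: branch_image_map; apply: branch_dom_source => //; apply: IH.
Qed.

Lemma branch_shift_ge0 b : 0 <= branch_shift b.
Proof. by case: b. Qed.

(** By injectivity, the branch and its result determine the whole application; disjointness of the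
    images then determines the branch too. *)
Lemma producesP (R : realType) b m (z : R * R) n w :
  produces R (b, m, z) n w ->
  [/\ branch_image R b w, m = n - branch_shift b & z = branch_inv R b w].
Proof.
move=> [m0 lz dz -> ->].
have sz : branch_source R b z.
  exact/branch_dom_source/dz/level_ge0_nonvertex/lz.
by rewrite branch_mapK // addrK; split => //; exact: branch_image_map.
Qed.

Lemma produces_inj (R : realType) a a' n (w : R * R) :
  produces R a n w -> produces R a' n w -> a = a'.
Proof.
case: a a' => [[b m] z] [[b' m'] z'].
move=> /producesP [iw -> ->] /producesP [iw' -> ->].
by rewrite (branch_image_disjoint _ _ _ _ iw iw').
Qed.

Lemma level_inv (R : realType) n (w : R * R) : level R n w ->
  [\/ n = -1 /\ [set (0, 0); (1, 0); (1, 1)] w, n = 0 /\ seeds R w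
    | exists a, produces R a n w].
Proof.
case=> [z hz|z hz|b m z m0 lz dz]; [by constructor 1|by constructor 2|].
by constructor 3; exists (b, m, z).
Qed.

(** The midpoint of the diagonal lies in no image. The other two seeds are also generated, by
    [R2_phi2] and [R3_phi0], but from a seed and without change of level. *)
Lemma seeds_branch_inv (R : realType) b (w : R * R) :
  seeds R w -> branch_image R b w ->
  branch_shift b = 0 /\ seeds R (branch_inv R b w).
Proof.
by move=> [[->|->]|->]; case: b; rewrite /branch_image /= => -[? ? ?];
  try (exfalso; lra); split=> //; [right|left; left; congr pair; field].
Qed.

Lemma seeds_level (R : realType) n (w : R * R) :
  0 <= n -> level R n w -> seeds R w -> n = 0.
Proof.
move=> n0 lw; elim: lw n0 => {n w} // b n z n0 lz IH dz _ sw.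
have [iw _ zE] : [/\ branch_image R b (branch_map R b z),
    n = n + branch_shift b - branch_shift b
    & z = branch_inv R b (branch_map R b z)].
  exact: (@producesP R b n z).
by have [-> ] := seeds_branch_inv _ _ _ sw iw; rewrite -zE addr0; exact: IH.
Qed.

(** Induction on the first derivation: a last rule application in the second must have the same
    branch and source, so the claim passes to the predecessor. Seeds end the descent. *)
Lemma level_inj (R : realType) n n' (w : R * R) :
  0 <= n -> 0 <= n' -> level R n w -> level R n' w -> n = n'.
Proof.
move=> n0 n0' lw; elim: lw n0 n' n0' => {n w} //.
  by move=> w sw _ n' n0' lw'; rewrite (seeds_level _ _ _ n0' lw').
move=> b n z n0 lz IH dz nb0 n' n0' lw'.
have pw : produces R (b, n, z) (n + branch_shift b) (branch_map R b z) by [].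
case: (level_inv _ _ _ lw') => [[nE]|[-> sw]|[[[b' m] z'] pw']].
- by rewrite nE in n0'.
- by apply: (seeds_level _ _ _ nb0 _ sw); exact: level_gen.
have [iw _ zE] := producesP _ _ _ _ _ _ pw.
have [iw' _ zE'] := producesP _ _ _ _ _ _ pw'.
have bE := branch_image_disjoint _ _ _ _ iw iw'.
have zz : z' = z by rewrite zE' -bE -zE.
case: pw' => m0 lz' _ -> _.
by rewrite bE (IH n0 m m0) // -zz.
Qed.

Lemma level_trivIset (R : realType) :
  trivIset [set n : int | -1 <= n] (level R).
Proof.
(* Shifts are nonnegative, so level [-1] holds only the vertices, which no later level contains. *)
have vE n w : 0 <= n -> level R (-1) w -> level R n w -> False.
  move=> n0 /level_inv [[_ vw]|[]//|[[[b m] z] [m0 _ _ mE _]]] lw.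
    by have := level_ge0_nonvertex _ _ _ n0 lw; rewrite nonvertexE => -[_].
  by have := branch_shift_ge0 b; lia.
have N1 (n : int) : -1 <= n -> n = -1 \/ 0 <= n by lia.
move=> n n' /= /N1 [->|n0] /N1 [->|n0'] [w [lw lw']] //.
- by case: (vE n' w).
- by case: (vE n w).
- exact: (level_inj _ _ _ w).
Qed.

(** * Rationality of the points of the tree *)

Lemma rational_branch_map (R : realType) b (z : R * R) :
  (rational `*` rational) z -> (rational `*` rational) (branch_map R b z).
Proof.
case: z => _ _ [/= [p _ <-] [q _ <-]].
case: b; rewrite /branch_map /phi0 /phi1 /phi2; split=> /=;
  solve [ by exists (1 / (1 + q)) => //; rewrite fmorph_div rmorphD rmorph1
        | by exists (p / (1 + q)) => //; rewrite fmorph_div rmorphD rmorph1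
        | by exists (q / (1 + q)) => //; rewrite fmorph_div rmorphD rmorph1
        | by exists p | by exists 0 => //; rewrite rmorph0 ].
Qed.

Lemma level_rational (R : realType) n (z : R * R) :
  level R n z -> (rational `*` rational) z.
Proof.
have r0 : rational (0 : R) by exists 0 => //; rewrite rmorph0.
have r1 : rational (1 : R) by exists 1 => //; rewrite rmorph1.
have r2 : rational (2^-1 : R) by exists 2^-1 => //; rewrite fmorphV rmorph_nat.
elim=> [{}z|{}z|b m {}z _ _ IH _]; last exact: rational_branch_map.
- by move=> [[->|->]|->].
- by move=> [[->|->]|->].
Qed.

(** * Completeness, by descent on a common denominator *)

Definition reached (R : realType) (z : R * R) : Prop :=
  exists2 n : int, 0 <= n & level R n z.

Lemma reached_image (R : realType) b (w : R * R) :
  branch_image R b w -> reached R (branch_inv R b w) -> reached R w.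
Proof.
move=> iw [n n0 lw]; exists (n + branch_shift b).
  by rewrite addr_ge0 // branch_shift_ge0.
rewrite -(branch_invK _ _ _ iw); apply: level_gen => //.
by apply: branch_source_dom; exact: branch_source_inv.
Qed.

(** Inverting [phi0] turns the common denominator [q] into [p]; inverting [phi1], as the next lemma
    shows, turns it into [q - r]. *)
Lemma branch_inv0_frac (F : fieldType) (p q r : F) : p != 0 -> q != 0 ->
  ((r / q) / (p / q), (p / q)^-1 - 1) = (r / p, (q - p) / p).
Proof. by move=> pn qn; congr pair; field; rewrite pn qn. Qed.

Lemma branch_inv1_frac (F : fieldType) (p q r : F) : q != 0 -> q - r != 0 ->
  ((p / q) / (1 - r / q), (r / q) / (1 - r / q)) = (p / (q - r), r / (q - r)).
Proof. by move=> qn dn; congr pair; field; rewrite qn dn. Qed.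

(** Strong induction on [q]; the fractions need not be reduced. The same-level rules keep [q], so
    the diagonal is settled first, then the bottom from it, then the right side from the bottom. *)
Lemma nonvertex_reached (R : realType) (q p r : nat) :
  nonvertex R (p%:R / q%:R, r%:R / q%:R) ->
  reached R (p%:R / q%:R, r%:R / q%:R).
Proof.
elim/ltn_ind: q p r => q IH p r nv.
have q0 : (0 < q)%N.
  rewrite lt0n; apply/eqP => qE; case: nv => b.
  (* Division by zero yields zero, so [q = 0] would give the vertex [(0, 0)]. *)
  rewrite qE invr0 !mulr0 {qE}.
  by case: b; rewrite /branch_source /= => -[? ? ?]; lra.
have Q0 : 0 < q%:R :> R by rewrite ltr0n.
have Qn := lt0r_neq0 Q0.
have IHb b w (q' p' r' : nat) : branch_image R b w -> (q' < q)%N ->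
    branch_inv R b w = (p'%:R / q'%:R, r'%:R / q'%:R) -> reached R w.
  move=> iw q'q wE; apply: (reached_image _ _ _ iw); rewrite wE.
  apply: IH => //.
  by rewrite -wE; exists b; exact: branch_source_inv.
have natn0 (k : nat) : (0 < k)%N -> k%:R != 0 :> R by rewrite pnatr_eq0 -lt0n.
have lt1 (k : nat) : (k%:R / q%:R < 1 :> R) = (k < q)%N.
  by rewrite ltr_pdivrMr // mul1r ltr_nat.
have gt0 (k : nat) : (0 < k%:R / q%:R :> R) = (0 < k)%N.
  by rewrite pmulr_lgt0 ?invr_gt0 // ltr0n.
have ltq (k l : nat) : (k%:R / q%:R < l%:R / q%:R :> R) = (k < l)%N.
  by rewrite ltr_pM2r ?invr_gt0 // ltr_nat.
have inv0 (k l : nat) : (0 < k <= q)%N ->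
    ((l%:R / q%:R) / (k%:R / q%:R), (k%:R / q%:R)^-1 - 1) =
    (l%:R / k%:R, (q - k)%:R / k%:R) :> R * R.
  by move=> /andP[k0 kq]; rewrite branch_inv0_frac ?natn0 // natrB.
have inv1 (k l : nat) : (l < q)%N ->
    ((k%:R / q%:R) / (1 - l%:R / q%:R), (l%:R / q%:R) / (1 - l%:R / q%:R)) =
    (k%:R / (q - l)%:R, l%:R / (q - l)%:R) :> R * R.
  move=> lq; have dn : (q - l)%:R != 0 :> R by rewrite natn0 // subn_gt0.
  by move: dn; rewrite natrB ?(ltnW lq) // => dn; rewrite branch_inv1_frac.
have half (k : nat) : (k%:R / q%:R < 2^-1 :> R) = (k + k < q)%N.
  by rewrite ltr_pdivrMr // ltr_pdivlMl // mulr_natl mulr2n -natrD ltr_nat.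
have half' (k : nat) : (2^-1 < k%:R / q%:R :> R) = (q < k + k)%N.
  by rewrite ltr_pdivlMr // ltr_pdivrMl // mulr_natl mulr2n -natrD ltr_nat.
have diag (k : nat) : (0 < k < q)%N -> reached R (k%:R / q%:R, k%:R / q%:R).
  move=> /andP[k0 kq].
  (* Below the midpoint the new denominator is [q - k], above it [k]; the midpoint itself is a
     seed. *)
  have [kh|kh|kh] := ltngtP (k + k) q.
  - apply: (IHb R2_phi1 _ (q - k) k k)%N.
    + by split=> //=; rewrite ?gt0 ?half.
    + by lia.
    + by rewrite /= inv1.
  - apply: (IHb R4_phi0 _ k k (q - k)%N).
    + by split=> //=; rewrite ?lt1 ?half'.
    + by [].
    + by rewrite /= inv0 // k0 ltnW.
  - exists 0 => //; apply: level_0; right.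
    by rewrite -kh natrD; congr pair; field;
      rewrite -natrD natn0 // addn_gt0 k0.
have bottom (k : nat) : (0 < k < q)%N -> reached R (k%:R / q%:R, 0).
  move=> kq; apply: (reached_image _ R2_phi2); last exact: diag.
  by split=> //=; rewrite ?gt0 ?lt1; case/andP: kq.
have right (k : nat) : (0 < k < q)%N -> reached R (1, k%:R / q%:R).
  move=> kq; apply: (reached_image _ R3_phi0).
    by split=> //=; rewrite ?gt0 ?lt1; case/andP: kq.
  by rewrite /= invr1 mulr1 subrr; exact: bottom.
have interior : (0 < r)%N -> (r < p)%N -> (p < q)%N ->
    reached R (p%:R / q%:R, r%:R / q%:R).
  move=> r0 rp pq.
  (* The position relative to the antidiagonal selects the branch; the new denominator is [q - r],
     [q - r] or [p], according as [p + r] is less than, equal to or greater than [q]. *)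
  have [h|h|h] := ltngtP (p + r) q.
  - apply: (IHb R1_phi1 _ (q - r) p r)%N.
    + by split=> /=; rewrite ?gt0 ?ltq // -mulrDl -natrD lt1.
    + by lia.
    + by rewrite /= inv1 //; lia.
  - apply: (IHb R1_phi0 _ p r (q - p)%N).
    + split=> /=; rewrite ?lt1 ?ltq //.
      by rewrite -mulrDl -natrD ltr_pdivlMr // mul1r ltr_nat.
    + by [].
    + by rewrite /= inv0 // (ltnW pq) (ltn_trans r0 rp).
  - apply: (IHb R4_phi1 _ p p r).
    + split=> /=; rewrite ?gt0 ?ltq //.
      by rewrite -mulrDl -natrD h divff.
    + by [].
    + have pE : (q - r)%N = p by lia.
      by rewrite /= inv1 ?pE ?divff ?natn0 //; lia.
case: nv => b; case: b; rewrite /branch_source /= => -[h1 h2 h3].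
- by apply: interior; [rewrite -gt0|rewrite -ltq|rewrite -lt1].
- by apply: interior; [rewrite -gt0|rewrite -ltq|rewrite -lt1].
- by rewrite h1; apply: diag; rewrite -gt0 -lt1 h2.
- by rewrite h1; apply: diag; rewrite -gt0 -lt1 h2.
- by rewrite h1; apply: bottom; rewrite -gt0 -lt1 h2.
- by rewrite h1; apply: right; rewrite -gt0 -lt1 h2.
- by rewrite h1; apply: right; rewrite -gt0 -lt1 h2.
Qed.

Lemma rational_triangle_reached (R : realType) (z : R * R) :
  (rational `*` rational) z -> nonvertex R z -> reached R z.
Proof.
case: z => x y [/= /rationalP [a [m xE]] /rationalP [b [n yE]]] nv.
have [x0 y0] : 0 <= x /\ 0 <= y.
  have [/= _ [yx y0]] := nonvertex_triangle _ _ nv.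
  by split=> //; exact: le_trans yx.
(* Nonnegativity makes the numerator natural; a zero denominator means [u = 0], rewritten as
   [0 / 1]. *)
have nd (k : nat) (c : int) (u : R) : 0 <= u -> u = c%:~R / k%:R ->
    exists (c' k' : nat), (0 < k')%N /\ u = c'%:R / k'%:R.
  move=> u0 uE; have [k0|k0] := posnP k.
    by exists 0%N, 1%N; rewrite uE k0 invr0 mulr0 mul0r.
  have K0 : 0 < k%:R :> R by rewrite ltr0n.
  exists `|c|%N, k; split => //; rewrite uE; congr (_ / _).
  suff : 0 <= c by case: c {uE}.
  by rewrite -(ler0z R) -(@pmulr_lge0 _ k%:R^-1) ?invr_gt0 -?uE.
have [p [s [s0 {}xE]]] := nd _ _ _ x0 xE.
have [r [t [t0 {}yE]]] := nd _ _ _ y0 yE.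
have sn : s%:R != 0 :> R by rewrite pnatr_eq0 -lt0n.
have tn : t%:R != 0 :> R by rewrite pnatr_eq0 -lt0n.
have {}xE : x = (p * t)%:R / (s * t)%:R.
  by rewrite xE !natrM; field; rewrite sn tn.
have {}yE : y = (r * s)%:R / (s * t)%:R.
  by rewrite yE !natrM; field; rewrite sn tn.
by rewrite xE yE in nv *; exact: nonvertex_reached.
Qed.

(** * Completeness and uniqueness of the tree *)

Theorem theorem5p4 (R : realType) :
  [/\ \bigcup_(n in [set n : int | -1 <= n]) level R n =
        (@rational R `*` @rational R) `&` triangle R,
      trivIset [set n : int | -1 <= n] (level R)
    & forall (n : int) (w : R * R), 1 <= n -> level R n w ->
        exists! a : branch * int * (R * R), produces R a n w].
Proof.
split; last first.
(* From level 1 on, a point is neither a vertex nor a seed by construction, so it comes from a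
   rule. *)
- move=> n w n1 /level_inv [[nE]|[nE]|[a pa]]; [by rewrite nE in n1..|].
  by exists a; split => // a'; exact: produces_inj.
- exact: level_trivIset.
apply/seteqP; split=> [z [n /= n1 lz]|z [qz tz]].
  split; first exact: level_rational lz.
  case/level_inv: (lz) => [[_]|[_ sz]|[[[b m] w] pz]].
  - by rewrite /triangle => -[[->|->]|->] /=; lra.
  - exact/nonvertex_triangle/seeds_nonvertex.
  - have [iz _ _] := producesP _ _ _ _ _ _ pz.
    exact/nonvertex_triangle/branch_image_nonvertex/iz.
have [vz|nvz] := pselect ([set (0, 0); (1, 0); (1, 1)] z).
  by exists (-1) => //; exact: level_m1.
have [|n n0 lz] := rational_triangle_reached _ _ qz.
  by rewrite nonvertexE.
by exists n => //=; lia.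
Qed.
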